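(* Let $0<q\le 1$, let $\mathbf{A}\in\mathbb{R}^{m\times n}$, and let $s\in\mathbb{N}$, $s\geq 1$. Suppose that $$\inf_{\mathbf{h}\in\ker(\mathbf{A})\setminus\{\mathbf{0}\}}\frac{\|\mathbf{h}\|_q}{\|\mathbf{h}\|_2}>3^{1/q}s^{1/q-1/2}.$$ Then for every nonzero $\mathbf{h}\in\ker(\mathbf{A})$ and every nonzero $\mathbf{x}_0\in\mathbb{R}^n$ with at most $s$ nonzero entries, $$\frac{\|\mathbf{x}_0\|_q^q}{\|\mathbf{x}_0\|_2^q}<\frac{\|\mathbf{x}_0+\mathbf{h}\|_q^q}{\|\mathbf{x}_0+\mathbf{h}\|_2^q}.$$ Consequently, every nonzero $\mathbf{x}_0$ with at most $s$ nonzero entries is exactly recovered by the $\ell_q/\ell_2$ minimization problem, i.e. is the unique minimizer of $$\min \frac{\|\mathbf{x}\|_q}{\|\mathbf{x}\|_2}\quad\text{subject to}\quad \mathbf{A}\mathbf{x}=\mathbf{b},\qquad\text{with } \mathbf{b}=\mathbf{A}\mathbf{x}_0.$$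
   Context: For $0<q\le1$ and $\mathbf{x}=(x_1,\dots,x_n)^T\in\mathbb{R}^n$, $\|\mathbf{x}\|_q=\left(\sum_{i=1}^n|x_i|^q\right)^{1/q}$. *)

(* Defs.v *)
From HB Require Import structures.
From mathcomp Require Import all_boot all_order all_algebra.
From mathcomp Require Import all_classical all_reals all_analysis.

Set Implicit Arguments.
Unset Strict Implicit.
Unset Printing Implicit Defensive.

Import Order.TTheory GRing.Theory Num.Theory.
Local Open Scope classical_set_scope.
Local Open Scope ring_scope.

(* Used at p = q and at p = 2. For p != 0, [0 `^ p = 0], so zero entries
   contribute nothing. *)
Definition lpnorm (R : realType) (p : R) (n : nat) (x : 'cV[R]_n) : R :=
  (\sum_(i < n) `|x i 0| `^ p) `^ p^-1.

Definition nnz (R : realType) (n : nat) (x : 'cV[R]_n) : nat :=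
  #|[set i : 'I_n | x i 0 != 0]%SET|.

Definition ker (R : realType) (m n : nat) (A : 'M[R]_(m, n)) : set 'cV[R]_n :=
  [set h | A *m h = 0].

(* Equals 0 at x = 0, where the quotient is undefined on paper: under this
   convention 0 can only defeat, never help, the minimality of another point. *)
Definition lq_l2_ratio (R : realType) (q : R) (n : nat) (x : 'cV[R]_n) : R :=
  lpnorm q x / lpnorm 2 x.

Definition is_minimizer (R : realType) (T : Type) (f : T -> R) (F : set T)
    (z : T) : Prop :=
  F z /\ forall x, F x -> f z <= f x.

Definition is_unique_minimizer (R : realType) (T : Type) (f : T -> R)
    (F : set T) (z : T) : Prop :=
  is_minimizer f F z /\ forall y, is_minimizer f F y -> y = z.

(* Main.v *)
Require Import Defs.
From HB Require Import structures.
From mathcomp Require Import all_boot all_order all_algebra.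
From mathcomp Require Import ring lra.
From mathcomp Require Import all_classical all_reals all_analysis.

(* Write N(x) = ||x||_q^q and T(x) = ||x||_2^q.  Both are subadditive because
   t |-> t^q is, and by concavity of t |-> t^(q/2) the entries of x on a set S
   of at most s indices satisfy N(x_S) <= c T(x) with c = s^(1 - q/2).  For S
   the support of x0,
     N(x0 + h) >= N(x0) + N(h) - 2 N(h_S) > N(x0) + 3 c T(h) - 2 c T(h)
                = N(x0) + c T(h),
   whereas T(x0 + h) <= T(x0) + T(h) and N(x0) <= c T(x0).  Cross-multiplying,
   N(x0) T(x0 + h) <= N(x0) T(x0) + c T(x0) T(h) < N(x0 + h) T(x0). *)

Set Implicit Arguments.
Unset Strict Implicit.
Unset Printing Implicit Defensive.

Import Order.TTheory GRing.Theory Num.Theory.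
Local Open Scope classical_set_scope.
Local Open Scope ring_scope.

(** The fractions [a / (a + b)] and [b / (a + b)] lie in [0, 1] and sum to 1, and a number of [0, 1]
    is at most its [q]-th power when [q <= 1]. *)
Lemma powR_subadditive (R : realType) (q a b : R) :
  0 < q -> q <= 1 -> 0 <= a -> 0 <= b -> (a + b) `^ q <= a `^ q + b `^ q.
Proof.
move=> q0 q1 a0 b0.
have [t0|t0] := eqVneq (a + b) 0.
  by rewrite t0 powR0 ?gt_eqF// addr_ge0 ?powR_ge0.
have tgt0 : 0 < a + b by rewrite lt0r t0 addr_ge0.
have frac_le c : 0 <= c -> c <= a + b ->
    (a + b) `^ q * (c / (a + b)) <= c `^ q.
  move=> c0 cab; have {2}-> : c = (a + b) * (c / (a + b)) by field.
  rewrite powRM ?divr_ge0 ?(ltW tgt0)// ler_wpM2l ?powR_ge0//.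
  have [->|cn0] := eqVneq c 0; first by rewrite mul0r powR_ge0.
  apply: ger1_powR => //.
  have cgt0 : 0 < c by rewrite lt0r cn0.
  by rewrite divr_gt0//= ler_pdivrMr// mul1r.
have := lerD (frac_le a a0 ltac:(lra)) (frac_le b b0 ltac:(lra)).
by rewrite -mulrDr -mulrDl divff// mulr1.
Qed.

(** The right side is the tangent at 1 of the concave map z |-> z^r. The bound is Young's inequality
    for z^r and 1 with conjugate exponents 1/r and 1/(1 - r). *)
Lemma powR_le_tangent1 (R : realType) (r z : R) :
  0 < r -> r < 1 -> 0 <= z -> z `^ r <= r * z + (1 - r).
Proof.
move=> r0 r1 z0.
have := @conjugate_powR R (z `^ r) 1 r^-1 (1 - r)^-1 (powR_ge0 _ _) ler01.
rewrite !invr_gt0 subr_gt0 => /(_ r0 r1).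
rewrite !invrK -powRrM divff ?gt_eqF// powRr1// mulr1 powR1 mul1r [z * r]mulrC.
by apply; ring.
Qed.

(** Jensen's inequality in tangent form: each [F i] is compared with the tangent at [M = Sigma / s].
    Dividing by [s] instead of [#|S|] puts [s] directly into the bound: the tangents sum to M^r (r s
    + (1 - r) #|S|), at most M^r s. *)
Lemma sum_powR_le (R : realType) (I : finType) (S : {set I}) (F : I -> R)
    (s : nat) (r : R) :
  0 < r -> r < 1 -> (forall i, 0 <= F i) -> (0 < s)%N -> (#|S| <= s)%N ->
  \sum_(i in S) F i `^ r <= s%:R `^ (1 - r) * (\sum_(i in S) F i) `^ r.
Proof.
move=> r0 r1 F0 s0 Ss; set Sigma := \sum_(i in S) F i.
have Sigma0 : 0 <= Sigma by apply: sumr_ge0.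
have sR0 : 0 < s%:R :> R by rewrite ltr0n.
have [Sigma_eq0|Sigma_neq0] := eqVneq Sigma 0.
  rewrite big1 ?mulr_ge0 ?powR_ge0// => i iS.
  have /psumr_eq0P/(_ Sigma_eq0 i iS) -> : forall i, i \in S -> 0 <= F i by [].
  by rewrite powR0 ?gt_eqF.
have M0 : 0 < Sigma / s%:R by rewrite divr_gt0// lt0r Sigma_neq0.
set M := Sigma / s%:R in M0 *.
have FM i : F i `^ r <= M `^ r * (r * (F i / M) + (1 - r)).
  have {1}-> : F i = M * (F i / M) by rewrite mulrC divfK ?gt_eqF.
  have z0 : 0 <= F i / M by rewrite divr_ge0// ltW.
  rewrite (powRM _ (ltW M0) z0) ler_wpM2l ?powR_ge0//.
  exact: powR_le_tangent1.
apply: (le_trans (ler_sum _ (fun i _ => FM i))).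
rewrite -mulr_sumr big_split/= -mulr_sumr -mulr_suml sumr_const -/Sigma.
have -> : Sigma / M = s%:R by rewrite /M invf_div mulrC divfK.
have -> : s%:R `^ (1 - r) * Sigma `^ r = M `^ r * s%:R.
  have -> : Sigma = M * s%:R by rewrite divfK ?gt_eqF.
  rewrite (powRM _ (ltW M0) (ltW sR0)) mulrCA -powRD.
    by rewrite subrK powRr1 ?ltW.
  by rewrite (gt_eqF sR0) implybT.
rewrite ler_wpM2l ?powR_ge0// -[leLHS]addrC -mulr_natr.
have : (1 - r) * #|S|%:R <= (1 - r) * s%:R.
  by rewrite ler_wpM2l ?ler_nat// subr_ge0 ltW.
lra.
Qed.

Section lpnorm.
Variables (R : realType) (n : nat).
Implicit Types (x y : 'cV[R]_n) (p q : R).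

Lemma lpnorm_ge0 p x : 0 <= lpnorm p x.
Proof. exact: powR_ge0. Qed.

Lemma powR_lpnorm p x : p != 0 -> lpnorm p x `^ p = \sum_i `|x i 0| `^ p.
Proof.
move=> p0; rewrite /lpnorm -powRrM mulVf// powRr1//.
by apply: sumr_ge0 => i _; exact: powR_ge0.
Qed.

Lemma sqr_lpnorm2 x : lpnorm 2 x ^+ 2 = \sum_i x i 0 ^+ 2.
Proof.
rewrite -powR_mulrn ?lpnorm_ge0// powR_lpnorm ?pnatr_eq0//.
by apply: eq_bigr => i _; rewrite powR_mulrn// real_normK// num_real.
Qed.

Lemma lpnorm2_eq0 x : lpnorm 2 x = 0 -> x = 0.
Proof.
move=> x0; have := sqr_lpnorm2 x; rewrite x0 expr0n/= => /esym sum0.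
apply/colP => i; rewrite mxE; apply/eqP; rewrite -sqrf_eq0; apply/eqP.
by apply: (psumr_eq0P _ sum0) => // j _; exact: sqr_ge0.
Qed.

Lemma lpnorm2_gt0 x : x != 0 -> 0 < lpnorm 2 x.
Proof.
move=> x0; rewrite lt0r lpnorm_ge0 andbT.
by apply: contraNneq x0 => /lpnorm2_eq0 ->.
Qed.

Lemma ler_lpnorm2D x y : lpnorm 2 (x + y) <= lpnorm 2 x + lpnorm 2 y.
Proof.
have [->|x0] := eqVneq x 0; first by rewrite add0r lerDr lpnorm_ge0.
have [->|y0] := eqVneq y 0; first by rewrite addr0 lerDl lpnorm_ge0.
have := lpnorm2_gt0 x0; have := lpnorm2_gt0 y0.
have := sqr_lpnorm2 x; have := sqr_lpnorm2 y.
move: (lpnorm 2 x) (lpnorm 2 y) => a b sumy sumx b0 a0.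
rewrite -(@ler_pXn2r _ 2)// ?nnegrE ?addr_ge0 ?lpnorm_ge0 ?(ltW a0) ?(ltW b0)//.
(* Sum [(u + v)^2 <= (1 + b/a) u^2 + (1 + a/b) v^2] over the entries. *)
have -> : (a + b) ^+ 2 = (1 + b / a) * a ^+ 2 + (1 + a / b) * b ^+ 2.
  by field; rewrite !gt_eqF.
rewrite sqr_lpnorm2 sumx sumy !mulr_sumr -big_split/=.
apply: ler_sum => i _; rewrite mxE -subr_ge0.
set u := x i 0; set v := y i 0.
have -> : (1 + b / a) * u ^+ 2 + (1 + a / b) * v ^+ 2 - (u + v) ^+ 2 =
    (b * u - a * v) ^+ 2 / (a * b) by field; rewrite !gt_eqF.
by rewrite divr_ge0 ?sqr_ge0// mulr_ge0 ?ltW.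
Qed.

Lemma ler_powR_lpnorm2D q x y : 0 < q -> q <= 1 ->
  lpnorm 2 (x + y) `^ q <= lpnorm 2 x `^ q + lpnorm 2 y `^ q.
Proof.
move=> q0 q1.
apply: le_trans (powR_subadditive q0 q1 (lpnorm_ge0 _ _) (lpnorm_ge0 _ _)).
apply: ge0_ler_powR; rewrite ?nnegrE ?addr_ge0 ?lpnorm_ge0 ?(ltW q0)//.
exact: ler_lpnorm2D.
Qed.

(** This is [sum_powR_le] for the squared entries with r = q/2. Here [x] need not be sparse, so the
    bound also applies to a kernel vector restricted to the support of [x0]. *)
Lemma sum_powR_le_lpnorm2 q (s : nat) (S : {set 'I_n}) x :
  0 < q -> q <= 1 -> (0 < s)%N -> (#|S| <= s)%N ->
  \sum_(i in S) `|x i 0| `^ q <= s%:R `^ (1 - q / 2) * lpnorm 2 x `^ q.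
Proof.
move=> q0 q1 s0 Ss.
have powq (t : R) : 0 <= t -> t `^ q = (t ^+ 2) `^ (q / 2).
  by move=> t0; rewrite -powR_mulrn// -powRrM mulrC divfK ?pnatr_eq0.
rewrite [lpnorm 2 x `^ q]powq ?lpnorm_ge0// sqr_lpnorm2.
under eq_bigr do rewrite powq// real_normK ?num_real//.
apply: le_trans
  (@sum_powR_le R _ S (fun i => x i 0 ^+ 2) s (q / 2) _ _ _ s0 Ss) _.
- by rewrite divr_gt0.
- lra.
- by move=> i; exact: sqr_ge0.
rewrite ler_wpM2l ?powR_ge0//; apply: ge0_ler_powR.
- by rewrite divr_ge0// ltW.
- by rewrite nnegrE sumr_ge0// => i _; exact: sqr_ge0.
- by rewrite nnegrE sumr_ge0// => i _; exact: sqr_ge0.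
rewrite [leRHS](bigID [in S])/= lerDl sumr_ge0// => i _; exact: sqr_ge0.
Qed.

Lemma powR_lpnorm_sparse_le q (s : nat) x :
  0 < q -> q <= 1 -> (0 < s)%N -> (nnz x <= s)%N ->
  lpnorm q x `^ q <= s%:R `^ (1 - q / 2) * lpnorm 2 x `^ q.
Proof.
move=> q0 q1 s0 xs; rewrite [leLHS](powR_lpnorm x (lt0r_neq0 q0)).
rewrite (bigID [in [set i | x i 0 != 0]%SET])/= [X in _ + X]big1 ?addr0.
  exact: sum_powR_le_lpnorm2.
by move=> i; rewrite inE negbK => /eqP ->; rewrite normr0 powR0 ?gt_eqF.
Qed.

(** The bound holds entry by entry. Off the support of [x] both sides equal |h_i|^q. On it, |x_i|^q
    <= |x_i + h_i|^q + |h_i|^q; the factor 2 removes this last term and the copy inside N(h). *)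
Lemma powR_lpnormD_ge q x h : 0 < q -> q <= 1 ->
  lpnorm q x `^ q + lpnorm q h `^ q
    - 2 * \sum_(i in [set i | x i 0 != 0]%SET) `|h i 0| `^ q
  <= lpnorm q (x + h) `^ q.
Proof.
move=> q0 q1.
rewrite [leRHS](powR_lpnorm _ (lt0r_neq0 q0)).
rewrite [X in X + _ - _](powR_lpnorm _ (lt0r_neq0 q0)).
rewrite [X in _ + X - _](powR_lpnorm _ (lt0r_neq0 q0)).
rewrite mulr_sumr lerBlDr -big_split/=.
rewrite [X in _ + X]big_mkcond/= -big_split/=.
apply: ler_sum => i _; rewrite inE mxE.
have [->|xi0] /= := eqVneq (x i 0) 0.
  by rewrite normr0 powR0 ?gt_eqF// !add0r addr0.
have normx : `|x i 0| <= `|x i 0 + h i 0| + `|h i 0|.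
  by rewrite -{1}[x i 0](addrK (h i 0)) ler_normB.
have : `|x i 0| `^ q <= `|x i 0 + h i 0| `^ q + `|h i 0| `^ q.
  apply: le_trans (powR_subadditive q0 q1 _ _) => //.
  by apply: ge0_ler_powR; rewrite ?nnegrE ?addr_ge0 ?(ltW q0).
lra.
Qed.

End lpnorm.

(** The final estimate with all norms replaced by real numbers; [NS] stands for the part of N(h) on
    the support of [x0]. *)
Lemma ratio_perturb_lt (R : realFieldType) (c N0 T0 Nh Th NS N T : R) :
  0 < c -> 0 < T0 -> 0 < Th -> 0 < T -> 0 <= N0 ->
  N0 <= c * T0 -> 3 * c * Th < Nh -> NS <= c * Th ->
  N0 + Nh - 2 * NS <= N -> T <= T0 + Th ->
  N0 / T0 < N / T.
Proof.
move=> c0 T00 Th0 Tgt0 N00 N0_le Nh_gt NS_le N_ge T_le.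
rewrite ltr_pdivrMr// mulrAC ltr_pdivlMr//.
apply: (@le_lt_trans _ _ (N0 * (T0 + Th))); first by rewrite ler_wpM2l.
have N_gt : N0 + c * Th < N by lra.
apply: (@le_lt_trans _ _ ((N0 + c * Th) * T0)); last by rewrite ltr_pM2r.
have : N0 * Th <= c * T0 * Th by rewrite ler_pM2r.
lra.
Qed.

Theorem theorem4p1 (R : realType) (q : R) (m n s : nat) (A : 'M[R]_(m, n))
    (q_gt0 : 0 < q) (q_le1 : q <= 1) (s_ge1 : (1 <= s)%N)
    (* the infimum is +oo when ker A is trivial *)
    (inf_gt : ((3 `^ q^-1 * s%:R `^ (q^-1 - 2^-1))%R%:E <
      ereal_inf [set (lpnorm q h / lpnorm 2 h)%R%:E | h in ker A `\ 0%R])%E) :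
  (forall h x0 : 'cV[R]_n,
     ker A h -> h != 0 -> x0 != 0 -> (nnz x0 <= s)%N ->
     lpnorm q x0 `^ q / lpnorm 2 x0 `^ q
       < lpnorm q (x0 + h) `^ q / lpnorm 2 (x0 + h) `^ q) /\
  (forall x0 : 'cV[R]_n,
     x0 != 0 -> (nnz x0 <= s)%N ->
     is_unique_minimizer (@lq_l2_ratio R q n)
       [set x | A *m x = A *m x0] x0).
Proof.
have q_neq0 : q != 0 by rewrite gt_eqF.
have sR_gt0 : 0 < s%:R :> R by rewrite ltr0n.
have c_gt0 : 0 < s%:R `^ (1 - q / 2) :> R by exact: powR_gt0.
have T_gt0 (x : 'cV[R]_n) : x != 0 -> 0 < lpnorm 2 x `^ q.
  by move=> x0; exact/powR_gt0/lpnorm2_gt0.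
have divq (x : 'cV[R]_n) : lpnorm q x `^ q / lpnorm 2 x `^ q =
    (lpnorm q x / lpnorm 2 x) `^ q.
  rewrite powRM ?invr_ge0 ?lpnorm_ge0//; congr (_ * _).
  (* As a power with exponent -1, the inverse commutes with the exponent [q], even at [x = 0]. *)
  rewrite -[(lpnorm 2 x)^-1]powR_inv1 ?lpnorm_ge0// powRAC.
  by rewrite powR_inv1 ?powR_ge0.
have ratio_ge0 (x : 'cV[R]_n) : 0 <= lpnorm q x / lpnorm 2 x.
  by rewrite divr_ge0 ?lpnorm_ge0.
(* The infimum hypothesis raised to the power [q]: the threshold 3^(1/q) s^(1/q - 1/2) becomes 3
   s^(1 - q/2). *)
have ker_gt h : ker A h -> h != 0 ->
    3 * s%:R `^ (1 - q / 2) * lpnorm 2 h `^ q < lpnorm q h `^ q.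
  move=> Ah h0; rewrite -ltr_pdivlMr ?T_gt0// divq.
  have : 3 `^ q^-1 * s%:R `^ (q^-1 - 2^-1) < lpnorm q h / lpnorm 2 h.
    rewrite -lte_fin; apply: lt_le_trans inf_gt _.
    by apply: ereal_inf_lbound; exists h => //; split => //; exact/eqP.
  move=> /(gt0_ltr_powR q_gt0); rewrite !nnegrE mulr_ge0 ?powR_ge0//.
  move=> /(_ isT (ratio_ge0 h)).
  rewrite powRM ?powR_ge0// -!powRrM mulVf// powRr1//.
  by rewrite mulrBl mulVf// [2^-1 * q]mulrC.
have ratio_lt h x0 : ker A h -> h != 0 -> x0 != 0 -> (nnz x0 <= s)%N ->
     lpnorm q x0 `^ q / lpnorm 2 x0 `^ q
       < lpnorm q (x0 + h) `^ q / lpnorm 2 (x0 + h) `^ q.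
  move=> Ah h0 x00 x0s.
  have Nx0 := powR_lpnorm_sparse_le q_gt0 q_le1 s_ge1 x0s.
  have Nh := ker_gt h Ah h0.
  have hS := sum_powR_le_lpnorm2 h q_gt0 q_le1 s_ge1 x0s.
  have ND := powR_lpnormD_ge x0 h q_gt0 q_le1.
  have TD := ler_powR_lpnorm2D x0 h q_gt0 q_le1.
  have Tx0 := T_gt0 x0 x00; have Th := T_gt0 h h0.
  have x0h : x0 + h != 0.
    (* Otherwise [x0 = - h] is a sparse kernel vector, whose ratio is too small. *)
    apply/negP => /eqP x0h.
    have Ax0 : ker A x0.
      have /eqP : x0 + h = 0 by [].
      rewrite addr_eq0 => /eqP ->.
      by rewrite /ker/= mulmxN Ah oppr0.
    have := lt_le_trans (ker_gt x0 Ax0 x00) Nx0; apply/negP.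
    by rewrite -leNgt (ler_pM2r Tx0) ler_peMl ?ler1n// ltW.
  exact: (ratio_perturb_lt c_gt0 Tx0 Th (T_gt0 _ x0h) (powR_ge0 _ _)
    Nx0 Nh hS ND TD).
split; first exact: ratio_lt.
move=> x0 x00 x0s.
(* Take h = x - x0. The default ratio 0 at the origin does no harm: 0 is feasible only if [x0] is in
   the kernel, which its sparsity excludes. *)
have ratio_lt_feasible x : A *m x = A *m x0 -> x != x0 ->
    lq_l2_ratio q x0 < lq_l2_ratio q x.
  move=> Ax xx0.
  have Ah : ker A (x - x0) by rewrite /ker/= mulmxBr Ax subrr.
  have h0 : x - x0 != 0 by rewrite subr_eq0.
  have := ratio_lt _ _ Ah h0 x00 x0s.
  have -> : x0 + (x - x0) = x by rewrite addrC subrK.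
  rewrite [ltLHS]divq [ltRHS]divq => lt_q.
  rewrite ltNge; apply/negP => le_ratio.
  have le_q := ge0_ler_powR (ltW q_gt0) (ratio_ge0 x) (ratio_ge0 x0) le_ratio.
  by have := lt_le_trans lt_q le_q; rewrite ltxx.
split; last first.
  move=> y [Ay miny]; apply/eqP; apply: contraT => yx0.
  by have := miny x0 erefl; rewrite leNgt ratio_lt_feasible.
split; first exact: erefl.
move=> x Ax; have [->|xx0] := eqVneq x x0; first exact: lexx.
exact/ltW/ratio_lt_feasible.
Qed.
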